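(* Let $(X,d)$ be a compact metric space equipped with a Borel probability measure $\mu$. For every integer $t\in\{2,3,\ldots\}$ there exist a compact set $S\subseteq X$, an ultrametric $\rho$ on $S$, and a Borel probability measure $\nu$ supported on $S$ such that (i) $d(x,y)\le\rho(x,y)\le 16t\,d(x,y)$ for all $x,y\in S$; (ii) for every $x\in X$ and $r\ge 0$, $$\nu(B_d(x,r))\le\mu\bigl(B_d(x,33tr)\bigr)^{1-1/t}.$$
   Context: For a metric space $(X,d)$, $x\in X$ and $r\in[0,\infty)$, $B_d(x,r)=\{z\in X: d(x,z)\le r\}$ denotes the closed ball. An ultrametric on a set $S$ is a metric $\rho$ on $S$ satisfying $\rho(x,y)\le\max\{\rho(x,z),\rho(y,z)\}$ for all $x,y,z\in S$. A Borel probability measure $\nu$ supported on $S$ is regarded as a Borel measure on $X$ via $\nu(B)=\nu(B\cap S)$ for Borel $B\subseteq X$. *)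

(* Defs.v *)
From HB Require Import structures.
From mathcomp Require Import all_boot all_order all_algebra.
From mathcomp Require Import all_classical all_reals all_analysis.

Set Implicit Arguments.
Unset Strict Implicit.
Unset Printing Implicit Defensive.

Import Order.TTheory GRing.Theory Num.Theory.

Local Open Scope classical_set_scope.
Local Open Scope ring_scope.

(* [measurableType] requires a base point, which [metricType] does not provide.
   A space carrying a probability measure is nonempty, so requiring one is no
   restriction; the point itself is never used. *)
#[short(type="pointedMetricType")]
HB.structure Definition PointedMetric (R : numDomainType) :=
  {T of Metric R T & isPointed T}.

Notation borelType X := (g_sigma_algebraType (@open X)).

(* Not to be confused with the library's [closed_ball], the closure of an open
   ball, which may be smaller and is empty at radius 0. *)
Definition cball (R : numDomainType) (X : metricType R) (x : X) (r : R) : set X :=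
  [set z | mdist x z <= r].

(* Metrics on a subset [S] of [T] are functions on [T] of which only the
   restriction to [S] matters. *)
Record metric_on (R : numDomainType) (T : Type) (S : set T) (rho : T -> T -> R) :
    Prop := MetricOn {
  metric_on_ge0 : forall x y, S x -> S y -> 0 <= rho x y ;
  metric_on_eq0 : forall x y, S x -> S y -> (rho x y = 0 <-> x = y) ;
  metric_on_sym : forall x y, S x -> S y -> rho x y = rho y x ;
  metric_on_triangle : forall x y z, S x -> S y -> S z ->
    rho x y <= rho x z + rho z y }.

Definition ultrametric_on (R : numDomainType) (T : Type) (S : set T)
    (rho : T -> T -> R) : Prop :=
  metric_on S rho /\
  forall x y z, S x -> S y -> S z ->
    rho x y <= Num.max (rho x z) (rho y z).

Definition supported_on d (T : measurableType d) (R : realType)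
    (nu : probability T R) (S : set T) : Prop :=
  forall B : set T, measurable B -> nu B = nu (B `&` S).

(* Main.v *)
Require Import Defs.
From HB Require Import structures.
From mathcomp Require Import all_boot all_order all_algebra.
From mathcomp Require Import all_classical all_reals all_analysis.
From mathcomp Require Import ring lra.

(** The set S is the set of branches of a tree of closed cells, and nu is the
    image of Lebesgue measure on [0, 1) under a map that reads off branches.

    Fix scales s_k = D / 2^k and finite s_k/4-nets N_k of X, and let M_k(Z) be
    the largest measure that Z gives to a ball of radius s_k centred in N_k. A
    node of level k is a closed cell Z together with an interval [a, b) whose
    length is the nu-mass of Z. The invariant carried down the tree is

      (b - a) * M_k(Z)^(1/t) <= mu(Z).

    To pass to level k+1, a cell Z is carved (lemma [carve]). Take the point x
    of N_(k+1) whose ball of radius s_k/2 has the largest measure in Z, and t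
    annuli of width s_k/(4t) between the radii s_k/2 and 3 s_k/4. The t
    growth ratios telescope, so one annulus, from r to r', satisfies

      mu(Z n B(x,r')) <= mu(Z n B(x,r)) * (M_k(Z) / M_(k+1)(Z))^(1/t)

    ([growth_pigeonhole], [good_annulus]). The ball P = Z n B(x,r) becomes a
    cell of level k+1, the annulus is thrown away, and the rest of Z is carved
    again. P receives the share of [a, b) that is proportional to the measure of
    the larger ball B(x,r'), so that no mass is lost with the annulus. The
    inequality above is exactly what keeps the invariant for P. On the other
    hand M_k(Z) >= mu(Z n B(x,r')), so the invariant for Z bounds the share of P
    by mu(Z n B(x,r'))^(1 - 1/t), hence by the measure to that power of a ball
    of radius s_k = 2 s_(k+1) that contains P.

    Cells of level k have diameter at most 4 s_k, and distinct cells of level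
    k+1 are at distance at least s_k/(4t). So the ultrametric that gives
    distance 4 s_k to points separated between levels k and k+1 dominates d and
    has distortion 16t ([skeleton_ultrametric], [skeleton_dist_distortion]).

    For the ball bound ([skeleton_measure]), let E be the set of those points of
    B(x,r) that lie on a branch coded by a point of [0, 1), and k the last level
    at which a single cell contains E. Two points of E are separated at level
    k+1, so s_k/(4t) <= 2r, and the ball of radius 2 s_k containing the cell lies
    in B(x, r + 4 s_k), which is contained in B(x, 33tr). If no level separates
    E, the same bound at every level and continuity of mu from above give
    nu(B(x,r)) <= mu({y})^(1 - 1/t) for the only point y of E. *)

Set Implicit Arguments.
Unset Strict Implicit.

Import Order.TTheory GRing.Theory Num.Theory.

Local Open Scope classical_set_scope.
Local Open Scope ring_scope.

(** * Balls and nets in a compact metric space *)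

Lemma halving_small (R : realType) (D e : R) : 0 < e ->
  exists k, D / 2 ^+ k < e.
Proof.
move=> e0; exists (Num.truncn (D / e)).+1.
rewrite ltr_pdivrMr ?exprn_gt0// mulrC -ltr_pdivrMr//.
apply: lt_trans (truncnS_gt _) _.
by rewrite -natrX ltr_nat ltn_expl.
Qed.

Section metric_topology.
Context {R : realType} {X : pointedMetricType R}.
Implicit Types (x y z : X) (r s : R) (Z : set X).

Lemma mdist_triangle3 x y z r s : mdist x z <= r -> mdist z y <= s -> mdist x y <= r + s.
Proof. by move=> xz zy; apply: le_trans (metric_triangle x z y) _; exact: lerD. Qed.

Lemma open_metric_ball x r : open (ball x r).
Proof.
rewrite openE => y; rewrite ballEmdist/= => xy; apply/nbhs_ballP.
exists (r - mdist x y) => /=; first by rewrite subr_gt0.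
move=> z; rewrite !ballEmdist/= ltrBrDl => yz.
exact: le_lt_trans (metric_triangle x y z) _.
Qed.

Lemma closed_cball x r : closed (cball x r).
Proof.
rewrite -openC openE => y /=; rewrite /cball/= => /negP; rewrite -ltNge => xy.
apply/nbhs_ballP; exists (mdist x y - r) => /=; first by rewrite subr_gt0.
move=> z; rewrite ballEmdist/= ltrBrDr => yz; apply/negP; rewrite -ltNge.
have := metric_triangle x z y; rewrite (metric_sym z y) => tri.
by rewrite -(ltrD2r (mdist y z)); apply: lt_le_trans tri; rewrite addrC.
Qed.

Lemma cballS x y r s : mdist y x + r <= s -> cball x r `<=` cball y s.
Proof.
move=> yxr z; rewrite /cball/= => xz; apply: le_trans yxr.
exact: mdist_triangle3 (lexx _) xz.
Qed.

Lemma compact_finite_net : compact [set: X] -> forall e, 0 < e ->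
  exists N : seq X, forall x, exists2 y, y \in N & mdist y x <= e.
Proof.
move=> cX e e0; move: cX; rewrite compact_cover.
move=> /(_ X setT (fun x => ball x e)) [].
- by move=> x _; exact: open_metric_ball.
- by move=> x _; exists x => //; exact: ballxx.
move=> N _ covN; exists (finmap.enum_fset N) => x.
have [y yN] := covN x Logic.I; rewrite ballEmdist/= => /ltW yx.
by exists y.
Qed.

Lemma compact_bounded_radius : compact [set: X] -> exists2 D, 0 < D &
  exists x : X, [set: X] `<=` cball x D.
Proof.
move=> /compact_finite_net/(_ 1 ltr01) [N netN].
have [c HN] : exists c : R, 0 <= c /\ forall y, y \in N -> mdist point y <= c.
  elim: N {netN} => [|a N [c [c0 cN]]]; first by exists 0; split.
  exists (Num.max c (mdist point a)); split; first by rewrite le_max c0.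
  move=> y; rewrite inE => /orP[/eqP->|/cN yc]; rewrite le_max ?lexx ?orbT//.
  by rewrite yc.
exists (c + 1); first by have [c0 _] := HN; lra.
exists point => x _; have [y yN yx] := netN x.
have [_ /(_ _ yN) py] := HN.
exact: mdist_triangle3 py yx.
Qed.

End metric_topology.

(** * Masses of sets and of net balls *)

Section mass.
Context {R : realType} {X : pointedMetricType R} (mu : probability (borelType X) R).
Implicit Types (A B Z : set X).

Definition borel A := measurable (A : set (borelType X)).

Lemma borel_open A : open A -> borel A.
Proof. by move=> oA; apply: sub_sigma_algebra. Qed.

Lemma borel_closed A : closed A -> borel A.
Proof.
move=> cA; rewrite /borel -(setCK A); apply: measurableC.
by apply: borel_open; rewrite openC.
Qed.

Lemma borelI A B : borel A -> borel B -> borel (A `&` B).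
Proof. exact: measurableI. Qed.

Definition mass A : R := fine (mu A).

Lemma massE A : borel A -> mu A = (mass A)%:E.
Proof. by move=> mA; rewrite /mass fineK// fin_num_measure. Qed.

Lemma mass_ge0 A : 0 <= mass A.
Proof. by rewrite /mass fine_ge0. Qed.

Lemma massT : mass [set: X] = 1.
Proof. by rewrite /mass [mu _]probability_setT. Qed.

Lemma mass_le A B : borel A -> borel B -> A `<=` B -> mass A <= mass B.
Proof.
move=> mA mB AB; rewrite -lee_fin -!massE//.
by apply: le_measure => //; rewrite inE.
Qed.

Lemma mass_split A B : borel A -> borel B ->
  mass A = mass (A `&` B) + mass (A `\` B).
Proof.
move=> mA mB.
have mI : borel (A `&` B) by exact: measurableI.
have mD : borel (A `\` B) by exact: measurableD.
apply: EFin_inj; rewrite EFinD -!massE//.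
by rewrite addeC; exact: measureDI.
Qed.

(** A set of positive mass therefore gives positive mass to a ball of every
    covering finite net, which is what makes the growth ratios meaningful. *)
Lemma mass_cover0 A (N : seq X) (s : R) : borel A ->
  (forall x, A x -> exists2 y, y \in N & mdist y x <= s) ->
  (forall y, y \in N -> mass (A `&` cball y s) = 0) -> mass A = 0.
Proof.
elim: N A => [|a N IH] A mA cov null.
  suff -> : A = set0 by rewrite /mass measure0.
  by rewrite -subset0 => x /cov[].
have mb : borel (cball a s) by apply: borel_closed; exact: closed_cball.
rewrite (mass_split mA mb) null ?mem_head// add0r; apply: IH.
- exact: measurableD.
- move=> x [/cov[y]]; rewrite inE => /orP[/eqP->|yN yx] //; by exists y.
- move=> y yN; apply/eqP; rewrite eq_le mass_ge0 andbT.
  have my : borel (cball y s) by apply: borel_closed; exact: closed_cball.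
  rewrite -(null y) ?inE ?yN ?orbT//; apply: mass_le => //.
  + by apply: measurableI => //; exact: measurableD.
  + exact: measurableI.
  + by move=> x [[]].
Qed.

(** Ranging over a finite net makes the maximum attained, which a supremum over
    all centres need not be. *)
Definition maxmass (N : seq X) (s : R) Z : R :=
  \big[Num.max/0]_(y <- N) mass (Z `&` cball y s).

Lemma maxmass_ge0 N s Z : 0 <= maxmass N s Z.
Proof.
rewrite /maxmass; elim: N => [|a N IH]; first by rewrite big_nil.
by rewrite big_cons le_max IH orbT.
Qed.

Lemma le_maxmass N s Z y : y \in N -> mass (Z `&` cball y s) <= maxmass N s Z.
Proof.
rewrite /maxmass; elim: N => // a N IH; rewrite inE big_cons le_max.
by move=> /orP[/eqP->|/IH ->]; rewrite ?lexx ?orbT.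
Qed.

Lemma maxmass_le N s Z (c : R) : 0 <= c ->
  (forall y, y \in N -> mass (Z `&` cball y s) <= c) -> maxmass N s Z <= c.
Proof.
move=> c0 H; rewrite /maxmass; elim: N H => [|a N IH] H; first by rewrite big_nil.
by rewrite big_cons ge_max H ?mem_head// IH// => y yN; rewrite H// inE yN orbT.
Qed.

Lemma maxmassS N s Z Z' : closed Z -> closed Z' -> Z `<=` Z' ->
  maxmass N s Z <= maxmass N s Z'.
Proof.
move=> cZ cZ' ZZ'; apply: maxmass_le => [|y yN]; first exact: maxmass_ge0.
apply: le_trans (le_maxmass s Z' yN); apply: mass_le.
- by apply: borel_closed; apply: closedI => //; exact: closed_cball.
- by apply: borel_closed; apply: closedI => //; exact: closed_cball.
- exact: setSI.
Qed.

Lemma maxmass_attained N s Z : 0 < maxmass N s Z ->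
  exists2 y, y \in N & mass (Z `&` cball y s) = maxmass N s Z.
Proof.
rewrite /maxmass; elim: N => [|a N IH]; first by rewrite big_nil ltxx.
rewrite big_cons; set b := \big[_/_]_(_ <- _) _ in IH *.
case: (leP b (mass (Z `&` cball a s))) => [ba _|ab b0].
  by exists a; rewrite ?mem_head.
by have [y yN E] := IH b0; exists y; rewrite // inE yN orbT.
Qed.

End mass.

(** Otherwise every step from [b i] to [b i.+1] grows by more than the [t]-th
    root of [M / b 0], and [b t] exceeds [M]. *)
Lemma growth_pigeonhole (R : realType) (b : nat -> R) (t : nat) (M : R) :
  (0 < t)%N -> 0 < b 0%N -> b t <= M ->
  exists2 i, (i < t)%N & b i.+1 <= b i * (M / b 0%N) `^ t%:R^-1.
Proof.
move=> t0 b0 btM; set c := _ `^ _; apply: contrapT => H.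
have {}H i : (i < t)%N -> b i * c < b i.+1.
  by move=> it; rewrite ltNge; apply/negP => le; apply: H; exists i.
have c0 : 0 <= c by exact: powR_ge0.
have key i : (i < t)%N -> b 0%N * c ^+ i.+1 < b i.+1.
  elim: i => [|i IH] it; first by rewrite expr1; exact: H.
  rewrite exprSr mulrA; apply: le_lt_trans (H _ it).
  by apply: ler_wpM2r => //; apply: ltW; apply: IH; exact: ltnW.
have := key t.-1; rewrite prednK// => /(_ (leqnn t)) lt_bt.
have M0 : 0 <= M.
  by apply: le_trans btM; apply: le_trans (ltW lt_bt); rewrite mulr_ge0 ?exprn_ge0// ltW.
move: lt_bt; have -> : c ^+ t = M / b 0%N.
  by rewrite -powR_mulrn// -powRrM mulVf ?pnatr_eq0 -?lt0n// powRr1// divr_ge0// ltW.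
by rewrite mulrCA divff ?gt_eqF// mulr1 => /(le_lt_trans btM); rewrite ltxx.
Qed.

(** * Carving a cell *)

(** The interval [lo, hi) codes the mass of the cell: its length is the measure
    that the cell receives, and its points code the branches through the cell. *)
Record node (R : realType) (X : pointedMetricType R) :=
  Node { cell : set X ; lo : R ; hi : R }.

HB.instance Definition _ (R : realType) (X : pointedMetricType R) :=
  gen_eqMixin (node X).
HB.instance Definition _ (R : realType) (X : pointedMetricType R) :=
  gen_choiceMixin (node X).

Definition slot (R : realType) (X : pointedMetricType R) (n : node X) : set R :=
  [set u | lo n <= u < hi n].

Lemma count_lt (T : eqType) (p q : pred T) (s : seq T) x : x \in s ->
  (forall y, q y -> p y) -> p x -> ~~ q x -> (count q s < count p s)%N.
Proof.
move=> + qp px nqx; elim: s => //= a s IH; rewrite inE => /orP[/eqP<-|/IH lt_s].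
  by rewrite px (negbTE nqx) add0n add1n ltnS; exact: sub_count.
have [/qp ->|_] := boolP (q a); first by rewrite ltn_add2l.
by rewrite add0n; apply: leq_trans lt_s _; exact: leq_addl.
Qed.

Section carving.
Context {R : realType} {X : pointedMetricType R} (mu : probability (borelType X) R).
Variables (t : nat) (t_gt0 : (0 < t)%N).
Implicit Types (Z : set X) (N : seq X) (n : node X).

Let tR_gt0 : 0 < t%:R :> R. Proof. by rewrite ltr0n. Qed.

(** At scale [s], the first inequality is the invariant that lets carving
    continue below the node; the last clause records the bound on its mass that
    carving produced when the node was created, in terms of a ball that contains
    the cell. *)
Definition admissible N (s : R) n : Prop :=
  [/\ closed (cell n), 0 < mass mu (cell n), lo n < hi n,
      (hi n - lo n) * maxmass mu N s (cell n) `^ t%:R^-1 <= mass mu (cell n) &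
      exists2 x, cell n `<=` cball x (2 * s) &
        hi n - lo n <= mass mu (cball x (2 * s)) `^ (1 - t%:R^-1)].

Definition apart (e : R) Z1 Z2 : Prop :=
  forall x y, Z1 x -> Z2 y -> e <= mdist x y.

(** The children of a cell [Z] with interval [a, b), encoded by the map [g]
    sending a point of [a, b) to the child whose interval contains it; the
    children have scale [s], and [Z] has scale [2 * s]. *)
Definition refines N (s : R) Z (a b : R) (g : R -> node X) : Prop :=
  [/\ finite_set (range g),
      forall u, a <= u < b ->
        [/\ admissible N s (g u), cell (g u) `<=` Z, slot (g u) u,
            slot (g u) `<=` [set v | a <= v < b] &
            forall v, slot (g u) v -> g v = g u] &
      forall u v, a <= u < b -> a <= v < b -> g u <> g v ->
        apart (s / (2 * t%:R)) (cell (g u)) (cell (g v))].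

(** The annuli start at the radius [s], at the net point [x] maximising the mass
    of its ball in [Z]. Maximality bounds [maxmass] of the new cell by the
    innermost mass, and the outermost ball, of radius at most [3 * s / 2], fits
    in a ball of radius [2 * s] around a point of the coarser net [N], which
    bounds its mass by [maxmass] of [Z]. *)
Lemma good_annulus N N' (s : R) Z : 0 < s ->
  (forall x, exists2 y, y \in N & mdist y x <= s / 2) ->
  (forall x, exists2 y, y \in N' & mdist y x <= s) ->
  closed Z -> 0 < mass mu Z ->
  exists x r, let r' := r + s / (2 * t%:R) in
    [/\ x \in N', 0 < mass mu (Z `&` cball x s), s <= r & r' <= 2 * s] /\
    [/\ mass mu (Z `&` ball x r') <= maxmass mu N (2 * s) Z &
        mass mu (Z `&` ball x r') * maxmass mu N' s (Z `&` cball x r) `^ t%:R^-1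
          <= mass mu (Z `&` cball x r) * maxmass mu N (2 * s) Z `^ t%:R^-1].
Proof.
move=> s0 netN covN' cZ Z0.
have cI x r : closed (Z `&` cball x r) by apply: closedI => //; exact: closed_cball.
have bI x r : borel (Z `&` cball x r) by exact: borel_closed.
have M'0 : 0 < maxmass mu N' s Z.
  rewrite lt_neqAle maxmass_ge0 andbT eq_sym; apply/negP => /eqP M0.
  move: Z0; rewrite (@mass_cover0 _ _ mu Z N' s) ?ltxx//.
  - exact: borel_closed.
  - move=> y yN; apply/eqP; rewrite eq_le mass_ge0 andbT -M0.
    exact: le_maxmass.
have [x xN' xmax] := maxmass_attained M'0.
have e0 : 0 < s / (2 * t%:R) by rewrite divr_gt0// mulr_gt0.
have te : t%:R * (s / (2 * t%:R)) = s / 2.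
  by field; rewrite gt_eqF.
set e := s / (2 * t%:R) in e0 te *.
pose b i := mass mu (Z `&` cball x (s + i%:R * e)).
have b0E : b 0%N = maxmass mu N' s Z by rewrite /b mul0r addr0.
have b_le i : (i <= t)%N -> s + i%:R * e <= s + s / 2.
  by move=> it; rewrite lerD2l -te ler_pM2r// ler_nat.
have bM i : (i <= t)%N -> b i <= maxmass mu N (2 * s) Z.
  move=> /b_le it; have [y yN yx] := netN x.
  apply: le_trans (le_maxmass mu (2 * s) Z yN); apply: mass_le => //.
  by apply: setIS; apply: cballS; lra.
have [||i it bi] := @growth_pigeonhole R b t (maxmass mu N (2 * s) Z) t_gt0.
- by rewrite b0E.
- exact: bM.
have le_ball : mass mu (Z `&` ball x (s + i%:R * e + e)) <= b i.+1.
  apply: mass_le => //.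
  - apply: borelI; first exact: borel_closed.
    by apply: borel_open; exact: open_metric_ball.
  - apply: setIS => y; rewrite ballEmdist /cball/= => /ltW.
    by rewrite -natr1 mulrDl mul1r addrA.
exists x, (s + i%:R * e); split.
  split => //; first by rewrite xmax.
  - by rewrite lerDl mulr_ge0// ltW.
  - by have := b_le i.+1 it; rewrite -natr1 mulrDl mul1r addrA; lra.
split; first by apply: le_trans le_ball _; exact: bM.
have M_ge0 : 0 <= maxmass mu N (2 * s) Z by exact: maxmass_ge0.
apply: (@le_trans _ _ (b i.+1 * b 0%N `^ t%:R^-1)).
  apply: ler_pM => //; [exact: mass_ge0|exact: powR_ge0|].
  apply: ge0_ler_powR; rewrite ?nnegrE ?invr_ge0 ?ler0n ?maxmass_ge0 ?mass_ge0//.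
  by rewrite b0E; apply: maxmassS => //; exact: subIsetl.
have b00 : 0 < b 0%N by rewrite b0E.
apply: le_trans (ler_wpM2r (powR_ge0 _ _) bi) _.
rewrite -mulrA -powRM ?divr_ge0 ?(ltW b00)//.
by rewrite divfK ?gt_eqF.
Qed.

(** The carved ball takes the share of [a, b) proportional to the mass of the
    outer ball [ball x r'], the remainder [Q] keeps the rest of the interval and
    inherits the invariant because [maxmass] is monotone. The process stops
    since each round leaves no mass in the ball of radius [s] around the chosen
    net point: the number of net points with positive mass decreases. *)
Lemma carve N N' (s : R) : 0 < s ->
  (forall x, exists2 y, y \in N & mdist y x <= s / 2) ->
  (forall x, exists2 y, y \in N' & mdist y x <= s) ->
  forall Z a b, closed Z -> 0 < mass mu Z -> a < b ->
  (b - a) * maxmass mu N (2 * s) Z `^ t%:R^-1 <= mass mu Z ->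
  exists g, refines N' s Z a b g.
Proof.
move=> s0 netN covN' Z a b.
have [k] := ubnP (count (fun x => 0 < mass mu (Z `&` cball x s)) N').
elim: k Z a b => // k IH Z a b.
rewrite ltnS => cnt cZ Z0 ab abM.
have [x [r]] := good_annulus s0 netN covN' cZ Z0.
set r' := r + _ => -[[xN' x0 sr r's] [barM barP]].
have rr' : r < r' by rewrite ltrDl divr_gt0// mulr_gt0.
have bB x' q : borel (ball x' q) by apply: borel_open; exact: open_metric_ball.
have bC x' q : borel (cball x' q) by apply: borel_closed; exact: closed_cball.
have bZ : borel Z by exact: borel_closed.
set P := Z `&` cball x r in barP; set pbar := mass mu (Z `&` ball x r') in barM barP.
have cP : closed P by apply: closedI => //; exact: closed_cball.
have Ppbar : mass mu P <= pbar.
  apply: mass_le; [exact: borel_closed|exact: borelI|].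
  by apply: setIS => y; rewrite ballEmdist /cball/= => /le_lt_trans; exact.
have P0 : 0 < mass mu P.
  apply: lt_le_trans x0 _; apply: mass_le; [exact: borelI|exact: borel_closed|].
  by apply: setIS; apply: cballS; rewrite mdistxx add0r.
set Q := Z `\` ball x r'.
have cQ : closed Q.
  by rewrite /Q setDE; apply: closedI => //; apply: open_closedC; exact: open_metric_ball.
have bQ : borel Q by exact: borel_closed.
have ZE : mass mu Z = pbar + mass mu Q by exact: mass_split.
have M_ge0 : 0 <= maxmass mu N (2 * s) Z by exact: maxmass_ge0.
have pbar0 : 0 < pbar by exact: lt_le_trans Ppbar.
have M0 : 0 < maxmass mu N (2 * s) Z by exact: lt_le_trans barM.
set M := maxmass mu N (2 * s) Z in abM barM barP M_ge0 M0.
have Mt0 : 0 < M `^ t%:R^-1 by exact: powR_gt0.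
(* [th] is the coded length per unit of mass; it is the same for the carved ball
   and for the remainder. *)
pose th := (b - a) / mass mu Z.
have th0 : 0 < th by rewrite divr_gt0 ?subr_gt0.
have thM : th * M `^ t%:R^-1 <= 1.
  by rewrite /th mulrAC ler_pdivrMr// mul1r.
have thZ : th * mass mu Z = b - a by rewrite /th divfK ?gt_eqF.
pose c := a + th * pbar.
have ac : a < c by rewrite ltrDl mulr_gt0.
have bc : b - c = th * mass mu Q.
  by apply: (@addrI _ (th * pbar)); rewrite -mulrDr -ZE thZ /c; lra.
have goodP : admissible N' s (Node P a c).
  split => //=.
  - rewrite /c addrAC subrr add0r -mulrA.
    apply: le_trans (ler_wpM2l (ltW th0) barP) _.
    by rewrite mulrCA -[leRHS]mulr1; apply: ler_wpM2l => //; exact: mass_ge0.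
  - exists x; first by apply: subset_trans (@subIsetr _ _ _) _; apply: cballS;
      rewrite mdistxx add0r; lra.
    rewrite /c addrAC subrr add0r.
    apply: (@le_trans _ _ (pbar `^ (1 - t%:R^-1))).
      rewrite powRB; last by rewrite (gt_eqF pbar0) implybT.
      rewrite powRr1 ?(ltW pbar0)// ler_pdivlMr ?powR_gt0//.
      rewrite mulrAC -[leRHS]mul1r; apply: ler_wpM2r; first exact: ltW.
      apply: le_trans thM; apply: ler_wpM2l; first exact: ltW.
      by apply: ge0_ler_powR; rewrite ?nnegrE ?invr_ge0 ?ler0n ?(ltW pbar0).
    apply: ge0_ler_powR; rewrite ?nnegrE ?mass_ge0 ?subr_ge0 ?invf_le1 ?ler1n//.
    apply: mass_le => //; first exact: borelI.
    by move=> y [_]; rewrite ballEmdist /cball/= => /ltW /le_trans; apply.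
(* When the remainder is null the share of the carved ball is all of [a, b), so
   no point of the interval is left without a child. *)
have [Q0|Q0] := eqVneq (mass mu Q) 0.
  have cb : c = b by move: bc; rewrite Q0 mulr0 => /eqP; rewrite subr_eq0 => /eqP.
  rewrite {}cb in goodP ac.
  exists (fun=> Node P a b); split => //.
    apply: (@sub_finite_set _ _ [set Node P a b]) => //.
    by move=> n [].
  by move=> u abu; split=> //=; exact: subIsetl.
have {}Q0 : 0 < mass mu Q by rewrite lt_neqAle eq_sym Q0 mass_ge0.
have cb : c < b by rewrite -subr_gt0 bc mulr_gt0.
have Qsub : Q `<=` Z by exact: subDsetl.
have [||g [fing gP gsep]] := IH Q c b _ cQ Q0 cb.
- apply: leq_trans cnt; apply: (count_lt xN') => [y|//|].
    move=> /lt_le_trans; apply; apply: mass_le; [exact: borelI|exact: borelI|].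
    exact: setSI.
  rewrite -leNgt; apply: (@le_trans _ _ (mass mu set0)).
    apply: mass_le; [exact: borelI|by apply: borel_open; exact: open0|].
    move=> y [[_ xy]] /= sy; apply: xy; rewrite ballEmdist/=.
    apply: le_lt_trans sy _; exact: le_lt_trans rr'.
  by rewrite /mass measure0.
- rewrite bc mulrAC -[leRHS]mul1r; apply: ler_wpM2r; first exact: ltW.
  apply: le_trans thM; apply: ler_wpM2l; first exact: ltW.
  apply: ge0_ler_powR; rewrite ?nnegrE ?maxmass_ge0 ?invr_ge0 ?(ltW tR_gt0)//.
  exact: maxmassS.
have sepPQ : apart (s / (2 * t%:R)) P Q.
  move=> y z [_ xy] [_]; rewrite ballEmdist/= => /negP; rewrite -leNgt => xz.
  have := metric_triangle x y z; move: xy xz; rewrite /cball/= /r'; lra.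
exists (fun u => if u < c then Node P a c else g u); split.
- apply: (@sub_finite_set _ _ ([set Node P a c] `|` range g)).
    move=> n [u _]; case: ifP => _ <-; [by left|by right; exists u].
  by rewrite finite_setU; split.
- move=> u /andP[au ub]; case: ltP => uc.
    split => //=.
    + exact: subIsetl.
    + by rewrite /slot/= au.
    + by move=> v /andP[/= -> /lt_trans->].
    + by move=> v /andP[_ /= ->].
  have [|gg gQ gu gs gc] := gP u; first by rewrite uc.
  split => //.
  + exact: subset_trans Qsub.
  + by move=> v /gs/= /andP[cv ->]; rewrite andbT (le_trans _ cv)// ltW.
  + by move=> v vg; rewrite ltNge; have /andP[-> _] := gs _ vg; exact: gc.
- move=> u v /andP[au ub] /andP[av vb].
  case: ltP => uc; case: ltP => vc //=.
  + move=> _ y z Py gz; apply: sepPQ => //.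
    by have [|_ + _ _ _] := gP v; [rewrite vc|apply].
  + move=> _ y z gy Pz; rewrite metric_sym; apply: sepPQ => //.
    by have [|_ + _ _ _] := gP u; [rewrite uc|apply].
  + by apply: gsep; rewrite ?uc ?vc.
Qed.

End carving.

(** * The tree of cells *)

Section tree.
Context {R : realType} {X : pointedMetricType R} (mu : probability (borelType X) R).
Variables (t : nat) (t_gt0 : (0 < t)%N).

Let tR_gt0 : 0 < t%:R :> R. Proof. by rewrite ltr0n. Qed.

Definition unit_itv : set R := [set u | 0 <= u < 1].

(** [T k u] is the node of level [k] whose interval contains [u], so the tree is
    presented through the branches followed by the points of [0, 1). *)
Record coding_tree (N : nat -> seq X) (s : nat -> R) (T : nat -> R -> node X) : Prop := {
  tree_root : forall u, T 0 u = Node setT 0 1 ;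
  tree_finite : forall k, finite_set (T k @` unit_itv) ;
  tree_good : forall k u, unit_itv u -> admissible mu t (N k) (s k) (T k u) ;
  tree_slot : forall k u, unit_itv u -> slot (T k u) u ;
  tree_slot_const : forall k u v, unit_itv u -> slot (T k u) v -> T k v = T k u ;
  tree_cellS : forall k u, unit_itv u -> cell (T k.+1 u) `<=` cell (T k u) ;
  tree_slotS : forall k u, unit_itv u -> slot (T k.+1 u) `<=` slot (T k u) ;
  tree_separated : forall k u v, unit_itv u -> unit_itv v ->
    T k.+1 u <> T k.+1 v ->
    apart (s k.+1 / (2 * t%:R)) (cell (T k.+1 u)) (cell (T k.+1 v)) }.

(** Iterates [carve] from the root, the whole space with interval [0, 1). *)
Lemma tree_exists (N : nat -> seq X) (s : nat -> R) :
  (forall k, 0 < s k) -> (forall k, s k = 2 * s k.+1) ->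
  (forall k x, exists2 y, y \in N k & mdist y x <= s k / 4) ->
  (exists x : X, [set: X] `<=` cball x (2 * s 0%N)) ->
  exists T, coding_tree N s T.
Proof.
move=> s0 sS net [x0 Xx0].
have step k (n : node X) : exists g, admissible mu t (N k) (s k) n ->
    refines mu t (N k.+1) (s k.+1) (cell n) (lo n) (hi n) g.
  have [[cZ Z0 ab abM _]|bad] := pselect (admissible mu t (N k) (s k) n); last first.
    by exists (fun=> n).
  have [|x|x||g gP] := @carve R X mu t t_gt0 (N k) (N k.+1) (s k.+1)
    _ _ _ _ (lo n) (hi n) cZ Z0 ab.
  - exact: s0.
  - have [y yN yx] := net k x; exists y => //; move: yx; rewrite sS.
    by move/le_trans; apply; lra.
  - have [y yN yx] := net k.+1 x; exists y => //.
    by apply: le_trans yx _; have := s0 k.+1; lra.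
  - by rewrite -sS.
  by exists g.
pose G k n := projT1 (cid (step k n)).
have GP k n : admissible mu t (N k) (s k) n ->
  refines mu t (N k.+1) (s k.+1) (cell n) (lo n) (hi n) (G k n).
  by rewrite /G; case: cid.
pose T := fix T k u := if k is k'.+1 then G k' (T k' u) u else Node setT 0 1.
have TS k u : T k.+1 u = G k (T k u) u by [].
have root_good : admissible mu t (N 0%N) (s 0%N) (Node setT 0 1).
  split => /=; rewrite ?massT ?subr0 ?mul1r//.
    apply: (@le_trans _ _ (1 `^ t%:R^-1)); last by rewrite powR1.
    apply: ge0_ler_powR; rewrite ?nnegrE ?maxmass_ge0 ?invr_ge0 ?ler0n//.
    apply: maxmass_le => // y _; rewrite -(massT mu); apply: mass_le => //.
    + by rewrite setTI; apply: borel_closed; exact: closed_cball.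
    + exact: measurableT.
  exists x0 => //; suff -> : cball x0 (2 * s 0%N) = setT by rewrite massT powR1.
  by rewrite -subTset.
have inv k : finite_set (T k @` unit_itv) /\ forall u, unit_itv u ->
    [/\ admissible mu t (N k) (s k) (T k u), slot (T k u) u, slot (T k u) `<=` unit_itv &
        forall v, slot (T k u) v -> T k v = T k u].
  elim: k => [|k [fink IH]].
    split; last by move=> u u01; split.
    by apply: (@sub_finite_set _ _ [set Node setT 0 1]) => // n [].
  split.
    apply: (@sub_finite_set _ _ (\bigcup_(n in T k @` unit_itv) range (G k n))).
      move=> n [u u01 <-]; rewrite TS; exists (T k u); first by exists u.
      by exists u.
    apply: bigcup_finite => // n [u u01 <-].
    by have [/GP[]] := IH u u01.
  move=> u u01; have [gT uT sT cT] := IH u u01.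
  have [_ /(_ _ uT)[gS _ uS sS' cS] _] := GP _ _ gT.
  rewrite TS; split => // [v /sS'/sT//|v vS].
  by rewrite TS (cT v); [exact: cS|exact: sS'].
exists T; split => //.
- by move=> k; have [] := inv k.
- by move=> k u u01; have [_ /(_ u u01)[]] := inv k.
- by move=> k u u01; have [_ /(_ u u01)[]] := inv k.
- by move=> k u v u01; have [_ /(_ u u01)[_ _ _]] := inv k; apply.
- move=> k u u01; have [_ /(_ u u01)[gT uT _ _]] := inv k.
  by have [_ /(_ _ uT)[]] := GP _ _ gT.
- move=> k u u01; have [_ /(_ u u01)[gT uT _ _]] := inv k.
  by have [_ /(_ _ uT)[]] := GP _ _ gT.
(* Cells that were already apart at the previous level stay apart, because the
   required gap shrinks with the scale. *)
- elim=> [|k IH] u v u01 v01.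
    rewrite !TS /= => neq.
    by have [_ _ /(_ u v u01 v01 neq)] := GP 0%N _ root_good.
  have [_ /(_ u u01)[gT uT _ cT]] := inv k.+1.
  have [_ /(_ v v01)[gTv vT _ cTv]] := inv k.+1.
  have [E|ne _] := pselect (T k.+1 u = T k.+1 v).
    rewrite (TS k.+1) (TS k.+1 v) E => neq.
    rewrite E in uT.
    by have [_ _ /(_ u v uT vT neq)] := GP _ _ gTv.
  move=> x y; rewrite !(TS k.+1) => xu yv.
  have xu' : cell (T k.+1 u) x.
    by have [_ /(_ _ uT)[_ + _ _ _] _] := GP _ _ gT; apply.
  have yv' : cell (T k.+1 v) y.
    by have [_ /(_ _ vT)[_ + _ _ _] _] := GP _ _ gTv; apply.
  apply: le_trans (IH u v u01 v01 ne x y xu' yv').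
  rewrite ler_pM2r ?invr_gt0 ?mulr_gt0// (sS k.+1).
  by have := s0 k.+2; lra.
Qed.

End tree.

(** * The skeleton, its ultrametric and its measure *)

(** Normalising does nothing here, since [0, 1) has Lebesgue measure 1; it only
    presents the restricted measure as a probability. *)
Lemma uniform_law d (Y : measurableType d) (R : realType)
  (f : measurableTypeR R -> Y) :
  measurable_fun setT f ->
  exists nu : probability Y R, forall A, nu A =
    lebesgue_measure (f @^-1` A `&` `[0, 1[).
Proof.
move=> mf.
have mI : measurable (`[0, 1[%classic : set (measurableTypeR R)) by exact: measurable_itv.
have fM : f \in mfun by rewrite inE.
pose P := mnormalize (mrestr lebesgue_measure mI) (dirac (0 : measurableTypeR R)).
exists (distribution P (mfun_Sub fM)) => A.
rewrite /distribution /pushforward /P /= /mnormalize /= /mrestr setTI.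
rewrite lebesgue_measure_itv/= lte_fin ltr01 oppr0 adde0 onee_eq0/=.
by rewrite invr1 mule1.
Qed.

Section coding.
Context {R : realType} {X : pointedMetricType R} (mu : probability (borelType X) R).
Hypothesis compactX : compact [set: X].
Variables (t : nat) (t_gt1 : (1 < t)%N).
Variables (N : nat -> seq X) (s : nat -> R) (T : nat -> R -> node X).
Hypothesis s_gt0 : forall k, 0 < s k.
Hypothesis s_halve : forall k, s k = 2 * s k.+1.
Hypothesis s_small : forall e, 0 < e -> exists k, s k < e.
Hypothesis treeT : coding_tree mu t N s T.

Local Notation U := (@unit_itv R).

Let tR_gt0 : 0 < t%:R :> R. Proof. by rewrite ltr0n ltnW. Qed.

Lemma cell_closed k u : U u -> closed (cell (T k u)).
Proof. by move=> /(tree_good treeT k)[]. Qed.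

Lemma cell_nonempty k u : U u -> cell (T k u) !=set0.
Proof.
move=> /(tree_good treeT k)[_ + _ _ _]; apply: contraPP => /set0P/negP.
by rewrite negbK => /eqP->; rewrite /mass measure0 ltxx.
Qed.

Lemma cell_diam k u x y : U u -> cell (T k u) x -> cell (T k u) y ->
  mdist x y <= 4 * s k.
Proof.
move=> /(tree_good treeT k)[_ _ _ _ [c sub _]] /sub xc /sub yc.
move: xc; rewrite /cball/= metric_sym => xc.
by apply: le_trans (mdist_triangle3 xc yc) _; lra.
Qed.

Lemma cell_le j k u : U u -> (j <= k)%N -> cell (T k u) `<=` cell (T j u).
Proof.
move=> u01; elim: k => [|k IH]; first by rewrite leqn0 => /eqP->.
rewrite leq_eqVlt => /predU1P[->//|/IH]; apply: subset_trans.
exact: (tree_cellS treeT).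
Qed.

Lemma slot_unit k u : U u -> slot (T k u) `<=` U.
Proof.
move=> u01; elim: k => [|k IH]; first by rewrite (tree_root treeT).
exact: subset_trans (tree_slotS treeT u01) IH.
Qed.

Lemma cell_disjoint k u v x : U u -> U v ->
  cell (T k u) x -> cell (T k v) x -> T k u = T k v.
Proof.
case: k => [|k] u01 v01 xu xv; first by rewrite !(tree_root treeT).
apply: contrapT => /(tree_separated treeT u01 v01)/(_ x x xu xv).
by rewrite mdistxx leNgt divr_gt0// mulr_gt0.
Qed.

Definition skeleton : set X :=
  \bigcap_k \bigcup_(n in T k @` U) cell n.

Lemma skeleton_cell k x : skeleton x -> exists2 u, U u & cell (T k u) x.
Proof. by move=> /(_ k Logic.I)[n [u u01 <-]]; exists u. Qed.

Lemma skeleton_compact : compact skeleton.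
Proof.
apply: (subclosed_compact _ compactX) => //.
apply: closed_bigI => k _; apply: closed_bigcup.
  exact: (tree_finite treeT).
by move=> n [u u01 <-]; exact: cell_closed.
Qed.

Definition same_cell k (x y : X) : Prop :=
  exists2 u, U u & cell (T k u) x /\ cell (T k u) y.

Lemma same_cell0 x y : same_cell 0 x y.
Proof.
exists 0; first by rewrite /unit_itv/= lexx ltr01.
by rewrite (tree_root treeT).
Qed.

Lemma same_cell_sym k x y : same_cell k x y -> same_cell k y x.
Proof. by move=> [u u01 [xu yu]]; exists u. Qed.

Lemma same_cell_trans j k x y z :
  same_cell j x z -> same_cell k z y -> same_cell (minn j k) x y.
Proof.
move=> [u u01 [xu zu]] [v v01 [zv yv]]; exists u => //; split.
  exact: (cell_le u01 (geq_minl j k)).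
rewrite (@cell_disjoint (minn j k) u v z) //.
- exact: (cell_le v01 (geq_minr j k)).
- exact: (cell_le u01 (geq_minl j k)).
- exact: (cell_le v01 (geq_minr j k)).
Qed.

(** Carving to scale [s k.+1] leaves gaps of [s k.+1 / (2 * t)]. *)
Lemma split_dist k x y : skeleton x -> skeleton y -> ~ same_cell k.+1 x y ->
  s k / (4 * t%:R) <= mdist x y.
Proof.
move=> /(skeleton_cell k.+1)[u u01 xu] /(skeleton_cell k.+1)[v v01 yv] ns.
have ne : T k.+1 u <> T k.+1 v.
  by move=> E; apply: ns; exists u => //; rewrite E in xu *.
apply: le_trans (tree_separated treeT u01 v01 ne xu yv).
rewrite [s k]s_halve le_eqVlt; apply/orP; left; apply/eqP.
by field; rewrite gt_eqF.
Qed.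

(** As the scales decrease, this is [4 * s k] for the last level [k] with a
    common cell, and 0 when there is no last level. *)
Definition skeleton_dist (x y : X) : R :=
  inf [set 4 * s k | k in [set k | same_cell k x y]].

Lemma skeleton_dist_le k x y : same_cell k x y -> skeleton_dist x y <= 4 * s k.
Proof.
move=> xy; apply: ge_inf; last by exists k.
by exists 0 => _ [j _ <-]; rewrite mulr_ge0// ltW.
Qed.

Lemma le_skeleton_dist c x y :
  (forall k, same_cell k x y -> c <= 4 * s k) -> c <= skeleton_dist x y.
Proof.
move=> H; apply: lb_le_inf; first by exists (4 * s 0%N); exists 0%N => //; exact: same_cell0.
by move=> _ [k xy <-]; exact: H.
Qed.

Lemma skeleton_distC x y : skeleton_dist x y = skeleton_dist y x.
Proof.
by congr inf; apply/seteqP; split => _ [k xy <-]; exists k => //;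
  exact: same_cell_sym.
Qed.

Lemma dist_le_skeleton_dist x y : mdist x y <= skeleton_dist x y.
Proof. by apply: le_skeleton_dist => k [u u01 [xu yu]]; exact: cell_diam xu yu. Qed.

(** Common cells at levels [j] and [k] give a common cell at the coarser of the
    two levels, because cells of one level are disjoint. *)
Lemma skeleton_dist_ultra x y z :
  skeleton_dist x y <= Num.max (skeleton_dist x z) (skeleton_dist z y).
Proof.
rewrite leNgt; apply/negP; rewrite gt_max => /andP[xz zy].
have witness a b : skeleton_dist a b < skeleton_dist x y ->
    exists2 k, same_cell k a b & 4 * s k < skeleton_dist x y.
  move=> lt_ab; apply: contrapT => H.
  move: lt_ab; rewrite ltNge => /negP; apply; apply: le_skeleton_dist => k ab.
  by rewrite leNgt; apply/negP => lt_k; apply: H; exists k.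
have [j xzj sj] := witness _ _ xz; have [k zyk sk] := witness _ _ zy.
have := skeleton_dist_le (same_cell_trans xzj zyk).
by rewrite /minn; case: ifP => _; rewrite leNgt ?sj ?sk.
Qed.

(** Distinct points have a last level [k] with a common cell: their distance is
    at most [4 * s k] in the ultrametric, and at least the gap [s k / (4 * t)]
    left by carving that cell. *)
Lemma skeleton_dist_distortion x y : skeleton x -> skeleton y ->
  skeleton_dist x y <= 16 * t%:R * mdist x y.
Proof.
move=> Sx Sy.
have [all|[k0 nk0]] : (forall k, same_cell k x y) \/ exists k, ~ same_cell k x y.
  have [?|/existsNP ?] := pselect (forall k, same_cell k x y); [by left|by right].
  apply: (@le_trans _ _ 0); last by rewrite !mulr_ge0// mdist_ge0.
  apply/ler_addgt0Pl => e e0; rewrite addr0.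
  have [k sk] : exists k, s k < e / 4 by apply: s_small; rewrite divr_gt0.
  by apply: le_trans (skeleton_dist_le (all k)) _; lra.
have [k [xy nxy]] : exists k, same_cell k x y /\ ~ same_cell k.+1 x y.
  apply: contrapT => H; apply: nk0; elim: k0 => [|k IH]; first exact: same_cell0.
  by apply: contrapT => nk; apply: H; exists k.
apply: le_trans (skeleton_dist_le xy) _.
have := split_dist Sx Sy nxy; rewrite ler_pdivrMr ?mulr_gt0// => le_sk.
by rewrite mulrC in le_sk; have := ler_wpM2l (ler0n R 4) le_sk; lra.
Qed.

Lemma skeleton_ultrametric : ultrametric_on skeleton skeleton_dist.
Proof.
have dist_ge0 x y : 0 <= skeleton_dist x y.
  exact: le_trans (mdist_ge0 x y) (dist_le_skeleton_dist x y).
split; last by move=> x y z _ _ _; rewrite (skeleton_distC y z); exact: skeleton_dist_ultra.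
split=> //.
- move=> x y Sx Sy; split => [xy0|<-].
    apply: mdist_positivity; apply/eqP; rewrite eq_le mdist_ge0 andbT -xy0.
    exact: dist_le_skeleton_dist.
  apply/eqP; rewrite eq_le dist_ge0 andbT.
  by apply: le_trans (skeleton_dist_distortion Sx Sx) _; rewrite mdistxx mulr0.
- by move=> x y _ _; exact: skeleton_distC.
- move=> x y z _ _ _; apply: le_trans (skeleton_dist_ultra x y z) _.
  by rewrite ge_max lerDl lerDr !dist_ge0.
Qed.

Lemma branch_point u : U u -> exists x, forall k, cell (T k u) x.
Proof.
move=> u01; have := compactX; rewrite compact_In0.
move=> /(_ nat setT (fun k => cell (T k u))) [].
- exists (fun k => cell (T k u)) => [k _|k _]; first exact: cell_closed.
  by rewrite setTI.
- move=> D _; have [x xm] := cell_nonempty (\max_(i <- finmap.enum_fset D) i) u01.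
  exists x => i iD; apply: cell_le xm => //.
  exact: (@leq_bigmax_seq _ (finmap.enum_fset D) xpredT id).
- by move=> x H; exists x => k; exact: H.
Qed.

Lemma slot_itv (n : node X) : slot n = `[lo n, hi n[%classic.
Proof. by rewrite set_itvE. Qed.

(** [f u] is the point of the branch coded by [u]. It is measurable because the
    cells shrink to points: [f u] lies in an open set exactly when one of the
    cells of its branch does, and each level has finitely many intervals. *)
Lemma coding_map : exists f : measurableTypeR R -> borelType X,
  [/\ forall u, skeleton (f u), forall k u, U u -> cell (T k u) (f u) &
      measurable_fun setT f].
Proof.
have U0 : U 0 by rewrite /unit_itv/= lexx ltr01.
have /choice[g gP] u : exists x, U u -> forall k, cell (T k u) x.
  have [/branch_point[x xP]|nU] := pselect (U u); first by exists x.
  by exists point.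
(* Points outside [0, 1) carry no mass; they are sent into the skeleton as well,
   to the branch of 0. *)
pose f u : borelType X := if 0 <= u < 1 then g u else g 0.
have fin u : U u -> f u = g u by rewrite /f /unit_itv/= => ->.
exists f; split.
- move=> u k _; rewrite /f; case: ifPn => u01.
    by exists (T k u); [exists u|exact: gP].
  by exists (T k 0); [exists 0|exact: gP].
- by move=> k u u01; rewrite fin//; exact: gP.
apply: (@measurability _ _ (measurableTypeR R) (borelType X) _ _ (@open X)) => //.
move=> _ [V oV <-]; rewrite setTI.
have mU : measurable (U : set (measurableTypeR R)).
  have -> : U = `[0, 1[%classic by rewrite set_itvE.
  exact: measurable_itv.
have -> : f @^-1` V = \bigcup_k \bigcup_(n in T k @` U `&` [set n | cell n `<=` V]) slot n
    `|` (if pselect (V (g 0)) then ~` U else set0).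
  apply/seteqP; split => u /=.
    have [u01|u01] := pselect (U u); last first.
      by rewrite /f ifN; [move=> Vg; right; case: pselect|exact/negP].
    rewrite fin// => Vu; left.
    have /nbhs_ballP[e /= e0 eV] : nbhs (g u) V by exact: open_nbhs_nbhs.
    have [k sk] : exists k, s k < e / 4 by apply: s_small; rewrite divr_gt0.
    exists k => //; exists (T k u); last exact: (tree_slot treeT).
    split; first by exists u.
    move=> x /= xu; apply: eV; rewrite ballEmdist/=.
    by apply: le_lt_trans (cell_diam u01 (gP u u01 k) xu) _; lra.
  move=> [[k _ [_ [[v v01 <-] cV] uv]]|].
    have u01 := slot_unit v01 uv.
    rewrite fin//; apply: cV; rewrite -(tree_slot_const treeT v01 uv).
    exact: gP.
  case: pselect => // Vg nU.
  by rewrite /f ifN//; exact/negP.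
apply: measurableU; last by case: pselect => ?; [exact: measurableC|exact: measurable0].
apply: bigcup_measurable => k _; apply: fin_bigcup_measurable.
  by apply: finite_setIl; exact: (tree_finite treeT).
by move=> n _; rewrite slot_itv; exact: measurable_itv.
Qed.

(** Continuity of [mu] from above along the balls shrinking to [y]. *)
Lemma mass_cball_cvg (y : X) (l : R) :
  (forall k, l <= mass mu (cball y (4 * s k))) -> l <= mass mu [set y].
Proof.
move=> H.
have bB k : borel (cball y (4 * s k)) by apply: borel_closed; exact: closed_cball.
have capE : \bigcap_k cball y (4 * s k) = [set y].
  apply/seteqP; split => [z zB|_ -> k _]; last first.
    by rewrite /cball/= mdistxx mulr_ge0// ltW.
  apply/esym/mdist_positivity/eqP; rewrite eq_le mdist_ge0 andbT.
  apply/ler_addgt0Pl => e e0; rewrite addr0.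
  have [k sk] : exists k, s k < e / 4 by apply: s_small; rewrite divr_gt0.
  by apply: le_trans (zB k Logic.I) _; lra.
have b1 : borel [set y] by apply: borel_closed; rewrite -capE;
  apply: closed_bigI => k _; exact: closed_cball.
have cvg : mu \o (fun k => cball y (4 * s k)) @ \oo --> mu (\bigcap_k cball y (4 * s k)).
  apply: nonincreasing_cvg_mu => //.
  - by rewrite /= (massE _ (bB 0%N))// ltry.
  - by rewrite capE.
  - apply/nonincreasing_seqP => k; apply/subsetPset; apply: cballS.
    by rewrite mdistxx add0r [s k]s_halve; have := s_gt0 k.+1; lra.
rewrite -lee_fin -massE// -capE; apply: cvge_ge cvg.
by apply: nearW => k /=; rewrite massE// lee_fin.
Qed.

(** The law of the coding map under Lebesgue measure on [0, 1). The points coding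
    a set that stays within one cell of level [k] lie in the interval of that
    cell, whose length is bounded by admissibility; the radius [33 * t * r]
    comes from the last such level. *)
Lemma skeleton_measure : exists nu : probability (borelType X) R,
  supported_on nu skeleton /\
  forall x (r : R), 0 <= r ->
    (nu (cball x r) <= (mu (cball x (33 * t%:R * r))) `^ (1 - 1 / t%:R))%E.
Proof.
have [f [fS fc mf]] := coding_map; have [nu nuE] := uniform_law mf.
exists nu; split=> [B _|x r r0].
  rewrite !nuE; congr (lebesgue_measure (_ `&` _)).
  by apply/seteqP; split => [u Bu|u []].
have t1 : 1 <= t%:R :> R by rewrite ler1n ltnW.
rewrite nuE (massE mu); last by apply: borel_closed; exact: closed_cball.
rewrite poweR_EFin div1r; set E := f @^-1` _ `&` _.
have EU u : E u -> U u by move=> []; rewrite set_itvE.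
have Ex u : E u -> mdist x (f u) <= r by case.
have UE u : U u -> mdist x (f u) <= r -> E u by move=> u01 xu; split; rewrite ?set_itvE.
have mE : measurable E.
  apply: measurableI; last exact: measurable_itv.
  rewrite -[X in measurable X]setTI; apply: mf => //.
  by apply: borel_closed; exact: closed_cball.
have [[u0 Eu0]|nE] := pselect (E !=set0); last first.
  have -> : E = set0 by apply/seteqP; split => // u Eu; apply: nE; exists u.
  by rewrite measure0 lee_fin powR_ge0.
have U0 := EU _ Eu0.
have beta0 : 0 < 1 - t%:R^-1 :> R by rewrite subr_gt0 invf_lt1 ?ltr1n.
have in_cell k : (forall v, E v -> T k v = T k u0) ->
    (lebesgue_measure E <= (mass mu (cball (f u0) (4 * s k)) `^ (1 - t%:R^-1))%:E)%E.
  move=> Ek; have [_ _ lohi _ [c sub hl]] := tree_good treeT k U0.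
  apply: (@le_trans _ _ (lebesgue_measure (slot (T k u0) : set (measurableTypeR R)))).
    apply: le_measure; rewrite ?inE//; first by rewrite slot_itv; exact: measurable_itv.
    by move=> v Ev; rewrite -(Ek v Ev); apply: (tree_slot treeT); exact: EU.
  rewrite slot_itv lebesgue_measure_itv/= lte_fin lohi -EFinB lee_fin.
  apply: le_trans hl _; apply: ge0_ler_powR; rewrite ?nnegrE ?mass_ge0 ?(ltW beta0)//.
  apply: mass_le; [by apply: borel_closed; exact: closed_cball..|].
  apply: cballS; have := sub _ (fc k u0 U0); rewrite /cball/= metric_sym; lra.
(* Either no level separates the coded points of the ball, and the bound passes
   to the limit, or there is a last level [k] at which one cell contains them. *)
have [all|[k0 nk0]] : (forall k v, E v -> T k v = T k u0) \/
    exists k, ~ forall v, E v -> T k v = T k u0.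
  have [?|/existsNP ?] := pselect (forall k v, E v -> T k v = T k u0); [by left|by right].
  have [l lE] : exists l, lebesgue_measure E = l%:E.
    exists (fine (lebesgue_measure E)); rewrite fineK// ge0_fin_numE//.
    by apply: le_lt_trans (in_cell 0%N (all 0%N)) _; rewrite ltry.
  have l0 : 0 <= l by rewrite -lee_fin -lE.
  (* The exponent is moved to the left side so that only the measure itself
     has to pass to the limit. *)
  have l_le k : l `^ (1 - t%:R^-1)^-1 <= mass mu (cball (f u0) (4 * s k)).
    have := in_cell k (all k); rewrite lE lee_fin => lk.
    have -> : mass mu (cball (f u0) (4 * s k)) =
        (mass mu (cball (f u0) (4 * s k)) `^ (1 - t%:R^-1)) `^ (1 - t%:R^-1)^-1.
      by rewrite -powRrM divff ?gt_eqF// powRr1// mass_ge0.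
    by apply: ge0_ler_powR; rewrite ?nnegrE ?powR_ge0 ?invr_ge0 ?(ltW beta0).
  rewrite lE lee_fin.
  have -> : l = (l `^ (1 - t%:R^-1)^-1) `^ (1 - t%:R^-1).
    by rewrite -powRrM mulVf ?gt_eqF// powRr1.
  apply: ge0_ler_powR; rewrite ?nnegrE ?powR_ge0 ?mass_ge0 ?(ltW beta0)//.
  apply: le_trans (mass_cball_cvg l_le) _; apply: mass_le.
  - by apply: borel_closed; apply: accessible_closed_set1;
      apply: hausdorff_accessible; exact: metric_hausdorff.
  - by apply: borel_closed; exact: closed_cball.
  - move=> _ ->; rewrite /cball/=; apply: le_trans (Ex _ Eu0) _.
    by rewrite ler_peMl//; lra.
have [k [Ek nEk]] : exists k, (forall v, E v -> T k v = T k u0) /\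
    ~ forall v, E v -> T k.+1 v = T k.+1 u0.
  apply: contrapT => H; apply: nk0; elim: k0 => [|k IH].
    by move=> v _; rewrite !(tree_root treeT).
  by apply: contrapT => nk; apply: H; exists k.
have [v [Ev nv]] : exists v, E v /\ T k.+1 v <> T k.+1 u0.
  by apply: contrapT => H; apply: nEk => v Ev; apply: contrapT => nv; apply: H; exists v.
have V0 := EU _ Ev.
have nsame : ~ same_cell k.+1 (f v) (f u0).
  move=> [w w01 [vw uw]]; apply: nv.
  by rewrite (cell_disjoint V0 w01 (fc _ _ V0) vw) (cell_disjoint U0 w01 (fc _ _ U0) uw).
have sk : s k <= 2 * r * (4 * t%:R).
  rewrite -ler_pdivrMr ?mulr_gt0//; apply: le_trans (split_dist (fS v) (fS u0) nsame) _.
  have := Ex _ Ev; rewrite metric_sym => xv.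
  by apply: le_trans (mdist_triangle3 xv (Ex _ Eu0)) _; lra.
apply: le_trans (in_cell k Ek) _; rewrite lee_fin.
apply: ge0_ler_powR; rewrite ?nnegrE ?mass_ge0 ?(ltW beta0)//.
apply: mass_le; [by apply: borel_closed; exact: closed_cball..|].
apply: cballS; apply: le_trans (lerD (Ex _ Eu0) (lexx _)) _.
have : r <= t%:R * r by rewrite ler_peMl.
lra.
Qed.

End coding.

Unset Implicit Arguments.
Set Strict Implicit.

Theorem theorem3p1 (R : realType) (X : pointedMetricType R)
    (compactX : compact [set: X]) (mu : probability (borelType X) R)
    (t : nat) (t_ge2 : (2 <= t)%N) :
  exists (S : set X) (rho : X -> X -> R) (nu : probability (borelType X) R),
    [/\ compact S,
        ultrametric_on S rho,
        supported_on nu S,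
        (forall x y : X, S x -> S y ->
           mdist x y <= rho x y /\ rho x y <= 16 * t%:R * mdist x y) &
        (forall (x : X) (r : R), 0 <= r ->
           (nu (cball x r) <=
            (mu (cball x (33 * t%:R * r))) `^ (1 - 1 / t%:R))%E)].
Proof.
have [D D0 [c Xc]] := compact_bounded_radius compactX.
pose s k : R := D / 2 ^+ k.
have s_gt0 k : 0 < s k by rewrite divr_gt0// exprn_gt0.
have s_halve k : s k = 2 * s k.+1.
  by rewrite /s exprS; field; rewrite expf_neq0.
have s_small e : 0 < e -> exists k, s k < e by exact: halving_small.
have /choice[N netN] k : exists M : seq X, forall x, exists2 y, y \in M & mdist y x <= s k / 4.
  by apply: compact_finite_net => //; rewrite divr_gt0.
have Xc2 : exists x : X, [set: X] `<=` cball x (2 * s 0%N).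
  exists c; apply: subset_trans Xc _; apply: cballS.
  by rewrite mdistxx add0r /s expr0 divr1; lra.
have [T treeT] := tree_exists mu (ltnW t_ge2) s_gt0 s_halve netN Xc2.
have [nu [nuS nu_le]] := skeleton_measure compactX t_ge2 s_gt0 s_halve s_small treeT.
exists (skeleton T), (skeleton_dist s T), nu; split => //.
- exact: (skeleton_compact compactX treeT).
- exact: (skeleton_ultrametric t_ge2 s_gt0 s_halve s_small treeT).
- move=> x y Sx Sy; split; first exact: (dist_le_skeleton_dist treeT).
  exact: (skeleton_dist_distortion t_ge2 s_gt0 s_halve s_small treeT).
Qed.
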